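(* Let $X\in L^\infty$, $n\ge1$ and $\alpha_1,\dots,\alpha_n\in[0,1/2)$. Consider $n$ agents, agent $i$ having preference $\mathrm{IQD}_{\alpha_i}$, and allocations in $\mathbb A_n^+(X)$. (i) An allocation of $X$ is Pareto optimal in $\mathbb A_n^+(X)$ if and only if it is sum optimal in $\mathbb A_n^+(X)$. (ii) For $\lambda_1,\dots,\lambda_n\ge0$, $$\mathop{\boxplus}_{i=1}^n(\lambda_i\,\mathrm{IQD}_{\alpha_i})=\Big(\min_{i\in[n]}\lambda_i\Big)\,\mathrm{IQD}_{\max_{i\in[n]}\alpha_i}\quad\text{on }L^\infty.$$ In particular, $\mathop{\boxplus}_{i=1}^n\mathrm{IQD}_{\alpha_i}=\mathrm{IQD}_{\max_{i\in[n]}\alpha_i}$.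
   Context: $(\Omega,\mathcal F,\mathbb P)$ is an atomless probability space; a.s. equal random variables are identified; $L^\infty$ is the set of essentially bounded random variables; $[n]=\{1,\dots,n\}$. For $t\in[0,1]$, $Q_t^-(X)=\inf\{x\in\mathbb R:\mathbb P(X\le x)\ge1-t\}$ and $Q_t^+(X)=\inf\{x\in\mathbb R:\mathbb P(X\le x)>1-t\}$. For $\alpha\in[0,1/2)$, $\mathrm{IQD}_\alpha(X)=Q_\alpha^-(X)-Q_{1-\alpha}^+(X)$. Random variables $X_1,\dots,X_n$ are comonotonic if there are increasing (non-strictly) functions $f_i:\mathbb R\to\mathbb R$ and a random variable $Z$ with $X_i=f_i(Z)$ a.s. for all $i\in[n]$. $\mathbb A_n^+(X)$ is the set of comonotonic $(X_1,\dots,X_n)\in(L^\infty)^n$ with $\sum_{i=1}^nX_i=X$. For functionals $\rho_1,\dots,\rho_n:L^\infty\to\mathbb R$, $\mathop{\boxplus}_{i=1}^n\rho_i(X)=\inf\{\sum_{i=1}^n\rho_i(X_i):(X_1,\dots,X_n)\in\mathbb A_n^+(X)\}$. For preferences $\rho_1,\dots,\rho_n$ (smaller is better), $(X_1,\dots,X_n)\in\mathbb A_n^+(X)$ is sum optimal in $\mathbb A_n^+(X)$ if $\sum_i\rho_i(X_i)=\mathop{\boxplus}_{i=1}^n\rho_i(X)$; it is Pareto optimal in $\mathbb A_n^+(X)$ if for any $(Y_1,\dots,Y_n)\in\mathbb A_n^+(X)$ with $\rho_i(Y_i)\le\rho_i(X_i)$ for all $i$, one has $\rho_i(Y_i)=\rho_i(X_i)$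 for all $i$. *)

(* Defs.v *)
From HB Require Import structures.
From mathcomp Require Import all_boot all_order all_algebra.
From mathcomp Require Import all_classical all_reals all_analysis.
From mathcomp Require Import ess_sup_inf.

Set Implicit Arguments.
Unset Strict Implicit.
Unset Printing Implicit Defensive.

Import Order.TTheory GRing.Theory Num.Theory.
Import numFieldNormedType.Exports.

Local Open Scope classical_set_scope.
Local Open Scope ring_scope.

Definition atomless (d : measure_display) (T : measurableType d) (R : realType)
    (P : probability T R) : Prop :=
  forall A : set T, measurable A -> (0 < P A)%E ->
    exists B : set T,
      [/\ measurable B, B `<=` A, (0 < P B)%E & (P B < P A)%E].

(* Representatives of L^oo: essentially bounded measurable functions. The
   identification of a.s. equal variables is made by stating every equality
   between random variables below as an equality P-almost everywhere. *)
Notation Linfty P := (LfunType P (leey 1%E)).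

Section risk_sharing.
Context (d : measure_display) (T : measurableType d) (R : realType).
Variable P : probability T R.

(* Level t is counted from the upper tail: Q^-_0 is the essential supremum and
   Q^+_1 is the essential infimum. The infima are taken in \bar R since they are
   infinite for some levels (e.g. Q^-_1 = -oo, Q^+_0 = +oo). *)
Definition lquantile (t : R) (X : {RV P >-> R}) : \bar R :=
  ereal_inf [set x%:E | x in [set x : R | ((1 - t)%:E <= cdf X x)%E]].

Definition rquantile (t : R) (X : {RV P >-> R}) : \bar R :=
  ereal_inf [set x%:E | x in [set x : R | ((1 - t)%:E < cdf X x)%E]].

(* Both quantiles are finite for X in L^oo and 0 <= alpha < 1/2, so that [fine]
   loses nothing: see [IQDE]. *)
Definition IQD (alpha : R) (X : Linfty P) : R :=
  fine (lquantile alpha X - rquantile (1 - alpha) X)%E.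

Definition comonotonic (n : nat) (A : 'I_n -> Linfty P) : Prop :=
  exists (f : 'I_n -> R -> R) (Z : {RV P >-> R}),
    (forall i, {homo f i : x y / x <= y}) /\
    (forall i, \forall w \ae P, A i w = f i (Z w)).

Definition comonotonic_allocations (n : nat) (X : Linfty P) :
    set ('I_n -> Linfty P) :=
  [set A | comonotonic A /\ \forall w \ae P, \sum_(i < n) A i w = X w].

Definition boxplus (n : nat) (rho : 'I_n -> Linfty P -> R) (X : Linfty P) :
    \bar R :=
  ereal_inf [set (\sum_(i < n) rho i (A i))%:E
            | A in comonotonic_allocations (n := n) X].

Definition sum_optimal (n : nat) (rho : 'I_n -> Linfty P -> R) (X : Linfty P)
    (A : 'I_n -> Linfty P) : Prop :=
  comonotonic_allocations X A /\
  (\sum_(i < n) rho i (A i))%:E = boxplus rho X.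

Definition Pareto_optimal (n : nat) (rho : 'I_n -> Linfty P -> R)
    (X : Linfty P) (A : 'I_n -> Linfty P) : Prop :=
  comonotonic_allocations X A /\
  forall B : 'I_n -> Linfty P, comonotonic_allocations X B ->
    (forall i, rho i (B i) <= rho i (A i)) ->
    forall i, rho i (B i) = rho i (A i).

Lemma Linfty_ae_bounded (X : Linfty P) :
  exists M : R, \forall w \ae P, `|X w| <= M.
Proof.
have : (ess_sup P (abse \o (EFin \o X)) < +oo)%E.
  have : finite_norm P +oo%E X by exact: Lfunction_finite.
  rewrite /finite_norm unlock; case: ifPn => // /negP[].
  by rewrite [X in (_ < X)%E](@probability_setT _ _ _ P) lte01.
move=> Xfin; exists (fine (ess_sup P (abse \o (EFin \o X)))).
have ess_ge0 : (0 <= ess_sup P (abse \o (EFin \o X)))%E.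
  apply: ess_sup_gee; first by rewrite [X in (_ < X)%E](@probability_setT _ _ _ P) lte01.
  by apply: nearW => w /=; rewrite lee_fin.
have Efin : (ess_sup P (abse \o (EFin \o X)) \is a fin_num)%E.
  by rewrite ge0_fin_numE.
have := ess_sup_ge P (abse \o (EFin \o X)).
by apply: filterS => w /=; rewrite -lee_fin fineK.
Qed.

Lemma Linfty_cdf_bounds (X : Linfty P) : exists M : R,
  cdf (X : {RV P >-> R}) M = 1%E /\
  forall x, x < - M -> cdf (X : {RV P >-> R}) x = 0%E.
Proof.
have [M XM] := Linfty_ae_bounded X.
have mX (B : set R) : measurable B -> measurable (X @^-1` B).
  by move=> mB; rewrite -[X in measurable X]setTI; exact: measurable_funP.
exists M; split=> [|x xM]; rewrite /cdf /distribution /pushforward /=.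
  have -> : X @^-1` `]-oo, M] = ~` (X @^-1` `]M, +oo[).
    by rewrite preimage_setC setCitvr.
  rewrite probability_setC; last exact/mX.
  suff -> : P (X @^-1` `]M, +oo[) = 0%E by rewrite sube0.
  apply/negligibleP; first exact/mX.
  apply: negligibleS XM => w /=; rewrite in_itv /= andbT => Mw /(le_trans (ler_norm _)).
  by rewrite leNgt Mw.
apply/negligibleP; first exact/mX.
apply: negligibleS XM => w /=; rewrite in_itv /= => wx.
by move=> /ler_normlP[+ _]; rewrite lerNl leNgt (le_lt_trans wx xM).
Qed.

Lemma ereal_inf_fin_num (S : set R) (a b : R) :
  S b -> (forall x, S x -> a <= x) ->
  (ereal_inf [set x%:E | x in S] \is a fin_num)%E.
Proof.
move=> Sb aS; rewrite fin_real//; apply/andP; split.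
  apply: (lt_le_trans (ltNyr a)); apply: le_ereal_inf_tmp => _ [x Sx <-].
  by rewrite lee_fin aS.
by apply: (le_lt_trans _ (ltry b)); apply: ereal_inf_lbound; exists b.
Qed.

Lemma lquantile_fin_num (t : R) (X : Linfty P) :
  0 <= t < 1 -> (lquantile t X \is a fin_num)%E.
Proof.
case/andP=> t0 t1; have [M [XM XNM]] := Linfty_cdf_bounds X.
apply: (@ereal_inf_fin_num _ (- M) M) => [|x] /=.
  by rewrite XM lee_fin gerBl.
by apply: contraTT; rewrite -!ltNge => /XNM ->; rewrite lte_fin subr_gt0.
Qed.

Lemma rquantile_fin_num (t : R) (X : Linfty P) :
  0 < t <= 1 -> (rquantile t X \is a fin_num)%E.
Proof.
case/andP=> t0 t1; have [M [XM XNM]] := Linfty_cdf_bounds X.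
apply: (@ereal_inf_fin_num _ (- M) M) => [|x] /=.
  by rewrite XM lte_fin ltrBlDr ltrDl.
apply: contraTT; rewrite -ltNge -leNgt => /XNM ->.
by rewrite lee_fin subr_ge0.
Qed.

Lemma IQDE (alpha : R) (X : Linfty P) : 0 <= alpha < 2^-1 ->
  (IQD alpha X)%:E = (lquantile alpha X - rquantile (1 - alpha) X)%E.
Proof.
case/andP=> a0 a2; have a1 : alpha < 1.
  by apply: (lt_trans a2); rewrite invf_lt1 ?ltr1n.
rewrite /IQD fineK// fin_numB lquantile_fin_num ?a0//=.
by rewrite rquantile_fin_num// subr_gt0 a1 gerBl.
Qed.

End risk_sharing.

(* Main.v *)
(** Comonotonic variables are nondecreasing functions of a single Z, so their
    sublevel sets are nested and quantiles, hence IQD_alpha, are additive on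
    comonotonic allocations. As IQD_alpha is nonnegative and nonincreasing in
    alpha, this bounds the sum of the lambda_i IQD_{alpha_i} from below by
    min(lambda) IQD_{max(alpha)}. Conversely, clip Y to its quantile interval
    at the level max(alpha): the clipped part can be shared in any proportions
    w, while the remaining tail risk costs nothing to an agent m with maximal
    alpha_m. Giving the clipped part to an agent with minimal lambda attains
    the bound; sharing it in proportion to IQD_{max(alpha)}(A_i) dominates a
    given allocation A, so a Pareto optimal A attains the minimal sum. *)
Require Import Defs.
From mathcomp Require Import all_boot all_order all_algebra.
From mathcomp Require Import all_classical all_reals all_analysis.
From mathcomp Require Import measurable_realfun ess_sup_inf lra.

Import Order.TTheory GRing.Theory Num.Theory.
Import numFieldNormedType.Exports.

Local Open Scope classical_set_scope.
Local Open Scope ring_scope.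

(** * Finite chains of sets *)

Section chain_of_sets.
Context {T : Type} {I : finType} (D : I -> set T) (i0 : I).
Hypothesis chain : forall i j, D i `<=` D j \/ D j `<=` D i.

Lemma chain_min_seq (s : seq I) : exists i, forall j, j \in s -> D i `<=` D j.
Proof.
elim: s => [|j s [i min_i]]; first by exists i0.
have [Dij|Dji] := chain i j.
  by exists i => k; rewrite inE => /predU1P[->|/min_i].
exists j => k; rewrite inE => /predU1P[->//|/min_i]; exact: subset_trans.
Qed.

(** Meant for sublevel sets of comonotonic components: a point of the least one lies in all of
    them. *)
Lemma chain_min : exists i, forall j, D i `<=` D j.
Proof.
by have [i min_i] := chain_min_seq (enum I); exists i => j;
  apply: min_i; rewrite mem_enum.
Qed.

End chain_of_sets.

Lemma chain_max {T : Type} {I : finType} (D : I -> set T) (i0 : I) :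
  (forall i j, D i `<=` D j \/ D j `<=` D i) -> exists i, forall j, D j `<=` D i.
Proof.
move=> chain; have [|i max_i] := chain_min (fun i => ~` D i) i0.
  by move=> i j; case: (chain i j) => /subsetC; [right|left].
by exists i => j; rewrite -(setCK (D j)) -(setCK (D i)); exact: subsetC.
Qed.

(** Clipping and the shares built from it have this form; the slope bound controls how a shift past
    a quantile is transported by [h]. *)
Definition nondecreasing_nonexpansive {R : realType} (h : R -> R) : Prop :=
  forall x y, x <= y -> h x <= h y <= h x + (y - x).

(** * Quantiles under transformations and comonotonic sums *)

Section quantiles.
Context {d : measure_display} {T : measurableType d} {R : realType}.
Variable P : probability T R.
Implicit Types (X Y : Linfty P) (U V : \bar R -> Prop).

Lemma cdf_le_ae X Y x y : (\forall w \ae P, X w <= x -> Y w <= y) ->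
  (cdf (X : {RV P >-> R}) x <= cdf (Y : {RV P >-> R}) y)%E.
Proof.
have mX (Z : Linfty P) z : measurable (Z @^-1` `]-oo, z]).
  by rewrite -[X in measurable X]setTI; exact: measurable_funP.
move=> [N [mN N0 XY]]; rewrite /cdf /distribution /pushforward /=.
(* A null set covering the failures of the implication is added to the right-hand event. *)
rewrite -[leRHS](@measureU0 _ _ _ P _ N)//.
apply: le_measure; rewrite ?inE//; first exact: measurableU.
move=> w /=; rewrite !in_itv /= => Xx.
by have [Yy|Yy] := boolP (Y w <= y); [left|right; apply: XY => /(_ Xx)/(negP Yy)].
Qed.

(* The lower and upper quantiles at a common level are obtained from
   U = {p | 1 - t <= p} and U = {p | 1 - t < p}. *)
Definition is_quantile U X (q : R) : Prop :=
  (forall x, q < x -> U (cdf (X : {RV P >-> R}) x)) /\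
  (forall x, U (cdf (X : {RV P >-> R}) x) -> q <= x).

Lemma is_quantile_le U V X q r : (forall p, U p -> V p) ->
  is_quantile U X q -> is_quantile V X r -> r <= q.
Proof.
move=> UV [Uq _] [_ Vr]; apply/ler_addgt0Pr => e e0.
by apply/Vr/UV/Uq; rewrite ltrDl.
Qed.

Lemma is_quantile_uniq U X q r : is_quantile U X q -> is_quantile U X r -> q = r.
Proof.
by move=> Uq Ur; apply/eqP; rewrite eq_le !(@is_quantile_le U U X).
Qed.

(** As [h] has slope in [0, 1], [X <= q + e] forces [Y <= h q + e], and [Y < h q - e] forces
    [X < q - e]. *)
Lemma is_quantile_comp U X Y h q : (forall p p', (p <= p')%E -> U p -> U p') ->
  nondecreasing_nonexpansive h -> (forall w, Y w = h (X w)) ->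
  is_quantile U X q -> is_quantile U Y (h q).
Proof.
move=> Umon hne YE [Uq qU]; split=> x.
  move=> hqx; pose e := x - h q.
  have /Uq : q < q + e by rewrite ltrDl subr_gt0.
  apply: Umon; apply: cdf_le_ae; apply: nearW => w; rewrite YE => Xw.
  have [/hne|/ltW/hne] := leP (X w) q; rewrite /e in Xw *; lra.
move=> Ux; apply/ler_addgt0Pr => e e0.
rewrite leNgt; apply/negP => xhq.
have /qU : U (cdf (X : {RV P >-> R}) (q - e)); last by lra.
apply: Umon Ux; apply: cdf_le_ae; apply: nearW => w; rewrite YE => hx.
have [Xq|/ltW /hne qX] := leP (X w) q; last by lra.
by have := hne _ _ Xq; lra.
Qed.

(** The level [x] is split into levels [c i] of the components, whose sublevel sets are nested. Up
    to null sets, the least lies in the sublevel set of [X] at [x], and the largest contains it. *)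
Lemma is_quantile_sum U n (A : 'I_n -> Linfty P) X (q : 'I_n -> R) : (0 < n)%N ->
  (forall p p', (p <= p')%E -> U p -> U p') ->
  comonotonic_allocations X A -> (forall i, is_quantile U (A i) (q i)) ->
  is_quantile U X (\sum_(i < n) q i).
Proof.
move=> n0 Umon [[f [Z [fmon /filter_forall AfZ]]] AX] Uq.
have n0R : 0 < n%:R :> R by rewrite ltr0n.
pose D (c : 'I_n -> R) i := [set z | f i z <= c i].
have chain c i j : D c i `<=` D c j \/ D c j `<=` D c i.
  have [|/existsNP[z /not_implyP[fi fj]]] := pselect (D c i `<=` D c j); first by left.
  right => z' /= fj'; rewrite /D /=.
  have [zz'|/ltW z'z] := leP z z'.
    by exfalso; apply: fj; apply: le_trans fj'; exact: fmon.
  by apply: le_trans fi; exact: fmon.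
split=> x.
  (* Equal shares of the gap put every [c i] strictly above [q i], whichever index turns out to be
     minimal. *)
  move=> qx; pose c i := q i + (x - \sum_(i < n) q i) / n%:R.
  have cx : \sum_(i < n) c i = x.
    rewrite big_split/= sumr_const card_ord -[(_ / _) *+ _]mulr_natr.
    rewrite divfK ?gt_eqF//; lra.
  have [i min_i] := chain_min (D c) (Ordinal n0) (chain c).
  have /(Uq i).1 : q i < c i by rewrite ltrDl divr_gt0// subr_gt0.
  apply: Umon; apply: cdf_le_ae; near=> w => Aic.
  have <- : \sum_(i < n) A i w = X w by near: w.
  rewrite -cx; apply: ler_sum => j _.
  have AE k : A k w = f k (Z w) by move: k; near: w.
  by rewrite AE; apply: min_i; rewrite /D /= -AE.
move=> Ux; rewrite leNgt; apply/negP => xq.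
pose c i := q i - (\sum_(i < n) q i - x) / n%:R.
have cx : \sum_(i < n) c i = x.
  rewrite sumrB sumr_const card_ord -[(_ / _) *+ _]mulr_natr divfK ?gt_eqF//; lra.
have [i max_i] := chain_max (D c) (Ordinal n0) (chain c).
(* Outside the largest sublevel set every [A j] exceeds [c j], so the sum exceeds [x]. *)
have /(Uq i).2 : U (cdf (A i : {RV P >-> R}) (c i)).
  apply: Umon Ux; apply: cdf_le_ae; near=> w => Xx.
  have AE k : A k w = f k (Z w) by move: k; near: w.
  have AXw : \sum_(i < n) A i w = X w by near: w.
  rewrite leNgt; apply/negP => cA; move: Xx; apply/negP; rewrite -ltNge.
  rewrite -AXw -cx; apply: ltr_sum => [|j _].
    by apply/hasP; exists i; rewrite ?mem_index_enum.
  rewrite ltNge; apply/negP; rewrite AE => /(max_i j); rewrite /D /= -AE.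
  by rewrite leNgt cA.
by apply/negP; rewrite -ltNge ltrBlDr ltrDl divr_gt0// subr_gt0.
Unshelve. all: by end_near.
Qed.

Lemma nondecreasing_nonexpansive_comp X h : nondecreasing_nonexpansive h ->
  exists Y : Linfty P, forall w, Y w = h (X w).
Proof.
move=> hne.
have mh : measurable_fun setT (h \o X).
  apply: measurableT_comp; last exact: measurable_funP.
  by apply: nondecreasing_measurable => // x y /hne/andP[].
have fh : finite_norm P +oo%E (h \o X).
  have [M XM] := Linfty_ae_bounded X.
  rewrite /finite_norm unlock; case: ifPn => // _.
  (* A slope in [0, 1] gives |h x| <= |h 0| + |x|. *)
  apply: (@le_lt_trans _ _ (`|h 0| + M)%:E); last exact: ltry.
  apply/ess_supP; apply: filterS XM => w /= XM; rewrite lee_fin.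
  have [/[dup]/hne|/ltW/[dup]/hne] := leP 0 (X w); move: XM; rewrite !ler_norml;
    have := ler_norm (h 0); have := ler_norm (- h 0); rewrite normrN; lra.
have hX : h \o X \in Lfun P +oo%E by rewrite inE/=; apply/andP; split; rewrite inE.
by exists (Lfun_Sub (leey 1%E) hX).
Qed.

(** * Interquantile differences *)

Definition upper_level (alpha : R) : \bar R -> Prop :=
  fun p => ((1 - alpha)%:E <= p)%E.
(** The threshold of [rquantile (1 - alpha)], since 1 - (1 - alpha) = alpha. *)
Definition lower_level (alpha : R) : \bar R -> Prop :=
  fun p => (alpha%:E < p)%E.

Lemma is_quantile_ereal_inf U X : (forall p p', (p <= p')%E -> U p -> U p') ->
  let q := ereal_inf [set x%:E | x in [set x | U (cdf (X : {RV P >-> R}) x)]] in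
  (q \is a fin_num)%E -> is_quantile U X (fine q).
Proof.
move=> Umon q qfin; split=> x.
  rewrite -lte_fin fineK// => /ereal_inf_lt[_ [y Uy <-]]; rewrite lte_fin => yx.
  by apply: Umon Uy; apply: cdf_le_ae; apply: nearW => w /le_trans; apply; exact: ltW.
by move=> Ux; rewrite -lee_fin fineK//; apply: ereal_inf_lbound; exists x.
Qed.

Lemma upper_level_mono alpha p p' : (p <= p')%E ->
  upper_level alpha p -> upper_level alpha p'.
Proof. by rewrite /upper_level => pp' /le_trans; apply. Qed.

Lemma lower_level_mono alpha p p' : (p <= p')%E ->
  lower_level alpha p -> lower_level alpha p'.
Proof. by rewrite /lower_level => pp' /lt_le_trans; apply. Qed.

Lemma IQD_is_quantile alpha X : 0 <= alpha < 2^-1 -> exists u l : R,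
  [/\ is_quantile (upper_level alpha) X u, is_quantile (lower_level alpha) X l
    & IQD alpha X = u - l].
Proof.
move=> a01; have [a0 a1] : 0 <= alpha /\ alpha < 1 by move: a01; lra.
have ufin : (lquantile alpha (X : {RV P >-> R}) \is a fin_num)%E.
  by apply: lquantile_fin_num; rewrite a0 a1.
have lfin : (rquantile (1 - alpha) (X : {RV P >-> R}) \is a fin_num)%E.
  by apply: rquantile_fin_num; rewrite subr_gt0 a1 gerBl.
exists (fine (lquantile alpha (X : {RV P >-> R}))).
exists (fine (rquantile (1 - alpha) (X : {RV P >-> R}))); split.
- exact: (is_quantile_ereal_inf _ _ (upper_level_mono alpha)).
- move: lfin; rewrite /rquantile subKr.
  exact: (is_quantile_ereal_inf _ _ (lower_level_mono alpha)).
- by rewrite /IQD fineB.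
Qed.

(** Raising the level lowers the upper threshold and raises the lower one, so both quantiles move
    inwards. *)
Lemma IQD_antitone alpha beta X : 0 <= alpha -> alpha <= beta -> beta < 2^-1 ->
  IQD beta X <= IQD alpha X.
Proof.
move=> a0 ab b2.
have [|u [l [Hu Hl ->]]] := @IQD_is_quantile alpha X; first by lra.
have [|u' [l' [Hu' Hl' ->]]] := @IQD_is_quantile beta X; first by lra.
apply: lerB.
  apply: is_quantile_le Hu Hu' => p; rewrite /upper_level.
  by apply: le_trans; rewrite lee_fin lerB.
apply: is_quantile_le Hl' Hl => p; rewrite /lower_level.
by apply: le_lt_trans; rewrite lee_fin.
Qed.

(** Since alpha < 1 - alpha, a cdf value that reaches the upper threshold has already passed the
    lower one. *)
Lemma lower_le_upper_quantile alpha X l u : alpha < 2^-1 ->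
  is_quantile (lower_level alpha) X l -> is_quantile (upper_level alpha) X u ->
  l <= u.
Proof.
move=> a2 Hl Hu; apply: is_quantile_le Hu Hl => p.
by rewrite /upper_level/lower_level; apply: lt_le_trans; rewrite lte_fin; lra.
Qed.

Lemma IQD_ge0 alpha X : 0 <= alpha < 2^-1 -> 0 <= IQD alpha X.
Proof.
move=> a01; have [u [l [Hu Hl ->]]] := IQD_is_quantile alpha X a01.
by rewrite subr_ge0; apply: lower_le_upper_quantile Hl Hu; case/andP: a01.
Qed.

Lemma IQD_sum alpha n (A : 'I_n -> Linfty P) X : (0 < n)%N -> 0 <= alpha < 2^-1 ->
  comonotonic_allocations X A -> \sum_(i < n) IQD alpha (A i) = IQD alpha X.
Proof.
move=> n0 a01 AX.
have /choice[u /choice[l ul]] := fun i => IQD_is_quantile alpha (A i) a01.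
have [uX [lX [HuX HlX ->]]] := IQD_is_quantile alpha X a01.
under eq_bigr => i _ do have [_ _ ->] := ul i.
rewrite sumrB; congr (_ - _).
  apply: is_quantile_uniq HuX;
    apply: (is_quantile_sum _ _ _ _ _ n0 (upper_level_mono alpha) AX) => i.
  by have [] := ul i.
apply: is_quantile_uniq HlX;
  apply: (is_quantile_sum _ _ _ _ _ n0 (lower_level_mono alpha) AX) => i.
by have [] := ul i.
Qed.

(** * Allocations by clipping and the value of [boxplus] *)

(* Agent [i] receives the share [w i] of [Y] clipped to its quantile interval,
   and agent [m] also receives the tail risk [Y] minus its clipping, whose
   IQD vanishes at the largest level [alpha m]. *)
Lemma exists_allocation n (alpha w : 'I_n -> R) (m : 'I_n) Y :
  (forall i, 0 <= alpha i < 2^-1) -> (forall i, alpha i <= alpha m) ->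
  (forall i, 0 <= w i) -> \sum_(i < n) w i = 1 ->
  exists B : 'I_n -> Linfty P, comonotonic_allocations Y B /\
    forall i, IQD (alpha i) (B i) <= w i * IQD (alpha m) Y.
Proof.
move=> a01 am w0 w1.
have [b [a [Hb Ha ->]]] := IQD_is_quantile (alpha m) Y (a01 m).
have ab : a <= b.
  by apply: lower_le_upper_quantile Ha Hb; case/andP: (a01 m).
pose c x := Num.max a (Num.min b x).
pose h i x := w i * c x + (i == m)%:R * (x - c x).
have cE x : [\/ x <= a /\ c x = a, a <= x <= b /\ c x = x | b <= x /\ c x = b].
  rewrite /c; have [bx|/ltW xb] := leP b x.
    by constructor 3; rewrite (max_r ab).
  by have [ax|/ltW xa] := leP a x; [constructor 2; rewrite xb|constructor 1].
have cne : nondecreasing_nonexpansive c.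
  by move=> x y xy; case: (cE x) => -[? ->]; case: (cE y) => -[? ->];
    apply/andP; split; lra.
(* Shares at most 1 keep the slope of each [h i] at most 1. *)
have wle i : w i <= 1.
  by rewrite -w1 (bigD1 i)//= lerDl sumr_ge0.
have hne i : nondecreasing_nonexpansive (h i).
  move=> x y xy; have /andP[c1 c2] := cne _ _ xy; rewrite /h.
  have wc0 : 0 <= w i * (c y - c x) by rewrite mulr_ge0// subr_ge0.
  have wc1 : w i * (c y - c x) <= c y - c x by rewrite ler_piMl// subr_ge0.
  by case: (i == m); rewrite /= ?mul1r ?mul0r; lra.
have /choice[B BE] := fun i => nondecreasing_nonexpansive_comp Y (h i) (hne i).
exists B; split.
  split.
    exists h, (Y : {RV P >-> R}); split=> [i x y /(hne i)/andP[]//|i].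
    by apply: nearW => t; rewrite BE.
  apply: nearW => t; under eq_bigr do rewrite BE.
  rewrite /h big_split/= -mulr_suml w1 mul1r (bigD1 m)//= eqxx mul1r big1.
    by lra.
  by move=> i /negPf ->; rewrite mul0r.
move=> i.
have [ub [ua [Hub Hua _]]] := IQD_is_quantile (alpha i) Y (a01 i).
have [vb [va [Hvb Hva ->]]] := IQD_is_quantile (alpha i) (B i) (a01 i).
have -> : vb = h i ub.
  apply: is_quantile_uniq Hvb _; apply: is_quantile_comp (BE i) Hub => //.
  exact: upper_level_mono.
have -> : va = h i ua.
  apply: is_quantile_uniq Hva _; apply: is_quantile_comp (BE i) Hua => //.
  exact: lower_level_mono.
have cab x : a <= c x <= b.
  by rewrite /c le_max lexx /= ge_max ab ge_min lexx.
(* For [i = m] the two quantiles are the clipping bounds [b] and [a], which [c] fixes; any other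
   agent has tail coefficient 0. *)
have tail : (i == m)%:R * (ub - c ub) - (i == m)%:R * (ua - c ua) = 0.
  have [im|] := eqVneq i m; last by rewrite !mul0r subrr.
  rewrite im in Hub Hua.
  rewrite (is_quantile_uniq _ _ _ _ Hub Hb) (is_quantile_uniq _ _ _ _ Hua Ha).
  by rewrite /c (min_r ab) minxx (max_r ab) (max_l (lexx a)); lra.
have -> : h i ub - h i ua = w i * (c ub - c ua) by rewrite /h; lra.
apply: ler_wpM2l => //.
by have := cab ub; have := cab ua; lra.
Qed.

Lemma boxplus_scaled_IQD n (alpha lambda : 'I_n -> R) (m k : 'I_n) Y :
  (forall i, 0 <= alpha i < 2^-1) -> (forall i, alpha i <= alpha m) ->
  (forall i, 0 <= lambda i) -> (forall i, lambda k <= lambda i) ->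
  boxplus (fun i (Z : Linfty P) => lambda i * IQD (alpha i) Z) Y =
  (lambda k * IQD (alpha m) Y)%:E.
Proof.
move=> a01 am l0 lk; apply/eqP; rewrite eq_le; apply/andP; split.
  (* The whole clipped part goes to [k]; the IQD of every other agent is then at most 0, hence 0. *)
  have [||B [YB HB]] := @exists_allocation n alpha (fun i => (i == k)%:R) m Y a01 am.
  - by move=> i; rewrite ler0n.
  - rewrite (bigD1 k)//= eqxx big1 ?addr0// => i /negPf -> //.
  apply: (@le_trans _ _ (\sum_(i < n) lambda i * IQD (alpha i) (B i))%:E).
    by apply: ereal_inf_lbound; exists B.
  rewrite lee_fin (bigD1 k)//= big1 ?addr0.
    by rewrite ler_wpM2l//; have := HB k; rewrite eqxx mul1r.
  move=> i /negPf ik; have := HB i; rewrite ik mul0r => IQD0.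
  suff -> : IQD (alpha i) (B i) = 0 by rewrite mulr0.
  by apply/eqP; rewrite eq_le IQD0 IQD_ge0.
(* Lower bound: additivity at the common level [alpha m] splits the target over the [A i], and the
   comparison is then termwise. *)
apply: le_ereal_inf_tmp => _ [A YA <-]; rewrite lee_fin.
rewrite -(@IQD_sum (alpha m) n A Y)//; last exact: leq_ltn_trans (ltn_ord m).
rewrite mulr_sumr; apply: ler_sum => i _; apply: ler_pM => //.
  exact: IQD_ge0.
by apply: IQD_antitone => //; [case/andP: (a01 i)|case/andP: (a01 m)].
Qed.

Lemma boxplus_IQD n (alpha : 'I_n -> R) (m : 'I_n) Y :
  (forall i, 0 <= alpha i < 2^-1) -> (forall i, alpha i <= alpha m) ->
  boxplus (fun i (Z : Linfty P) => IQD (alpha i) Z) Y = (IQD (alpha m) Y)%:E.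
Proof.
move=> a01 am; rewrite -[IQD (alpha m) Y]mul1r.
rewrite -(@boxplus_scaled_IQD n alpha (fun=> 1) m m)//.
by congr (boxplus _ _); apply/funext => i; apply/funext => Z; rewrite mul1r.
Qed.

(** * Pareto optimality and sum optimality *)

(** Domination makes each difference of costs nonnegative and optimality makes their sum at most 0,
    so all of them vanish. *)
Lemma sum_optimal_Pareto n (rho : 'I_n -> Linfty P -> R) X A :
  sum_optimal rho X A -> Pareto_optimal rho X A.
Proof.
move=> [XA sumA]; split=> // B XB BA.
have sumBA : \sum_(i < n) rho i (A i) <= \sum_(i < n) rho i (B i).
  by rewrite -lee_fin sumA; apply: ereal_inf_lbound; exists B.
have : \sum_(i < n) (rho i (A i) - rho i (B i)) == 0.
  rewrite sumrB eq_le subr_le0 sumBA subr_ge0; exact: ler_sum.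
rewrite psumr_eq0; last by move=> i _; rewrite subr_ge0.
move=> /allP AB i; apply/eqP; rewrite eq_sym -subr_eq0.
by apply: (implyP (AB i _)); rewrite ?mem_index_enum.
Qed.

Lemma Pareto_sum_optimal_IQD n (alpha : 'I_n -> R) (m : 'I_n) X A :
  (forall i, 0 <= alpha i < 2^-1) -> (forall i, alpha i <= alpha m) ->
  Pareto_optimal (fun i => IQD (alpha i)) X A ->
  sum_optimal (fun i => IQD (alpha i)) X A.
Proof.
move=> a01 am [XA A_opt]; split=> //.
have n0 : (0 < n)%N by exact: leq_ltn_trans (ltn_ord m).
have sumA := IQD_sum (alpha m) n A X n0 (a01 m) XA.
have amA i : IQD (alpha m) (A i) <= IQD (alpha i) (A i).
  by apply: IQD_antitone => //; [case/andP: (a01 i)|case/andP: (a01 m)].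
have [w [w0 w1 wA]] : exists w : 'I_n -> R, [/\ forall i, 0 <= w i,
    \sum_(i < n) w i = 1 & forall i, w i * IQD (alpha m) X = IQD (alpha m) (A i)].
  (* In the degenerate case the IQDs of the [A i] at level [alpha m] are nonnegative with zero sum,
     so all vanish and any weights serve. *)
  have [X0|X0] := eqVneq (IQD (alpha m) X) 0.
    exists (fun i => (i == m)%:R); split=> [i||i].
    - by rewrite ler0n.
    - by rewrite (bigD1 m)//= eqxx big1 ?addr0// => i /negPf ->.
    - rewrite X0 mulr0; apply/esym/eqP; move/eqP: X0; rewrite -sumA psumr_eq0.
        by move=> /allP/(_ i (mem_index_enum i)).
      by move=> j _; exact: IQD_ge0.
  exists (fun i => IQD (alpha m) (A i) / IQD (alpha m) X); split=> [i||i].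
  - by rewrite divr_ge0// IQD_ge0.
  - by rewrite -mulr_suml sumA divff.
  - by rewrite divfK.
have [B [XB HB]] := exists_allocation n alpha w m X a01 am w0 w1.
(* [B] dominates [A]: its cost is at most [IQD (alpha m) (A i)], itself at most
   [IQD (alpha i) (A i)]. Pareto optimality turns this chain into equalities. *)
have BA : forall i, IQD (alpha i) (B i) = IQD (alpha i) (A i).
  by apply: A_opt => // i; apply: le_trans (HB i) _; rewrite wA.
rewrite (boxplus_IQD _ _ m)//; congr EFin; apply/eqP; rewrite eq_le.
rewrite -sumA; apply/andP; split; last exact: ler_sum.
by apply: ler_sum => i _; rewrite -BA -wA.
Qed.

End quantiles.

Theorem proposition9 (d : measure_display) (T : measurableType d)
    (R : realType) (P : probability T R) (hP : atomless P)
    (X : Linfty P) (n : nat) (hn : (0 < n)%N) (alpha : 'I_n -> R)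
    (halpha : forall i, 0 <= alpha i < 2^-1) :
  let i0 : 'I_n := Ordinal hn in
  let alpha_max : R := \big[Num.max/alpha i0]_(i < n) alpha i in
  (forall A : 'I_n -> Linfty P,
     Pareto_optimal (fun i => IQD (alpha i)) X A <->
     sum_optimal (fun i => IQD (alpha i)) X A)
  /\
  (forall lambda : 'I_n -> R, (forall i, 0 <= lambda i) ->
     forall Y : Linfty P,
       boxplus (fun i (Z : Linfty P) => lambda i * IQD (alpha i) Z) Y =
       ((\big[Num.min/lambda i0]_(i < n) lambda i) * IQD alpha_max Y)%:E)
  /\
  (forall Y : Linfty P,
     boxplus (fun i (Z : Linfty P) => IQD (alpha i) Z) Y = (IQD alpha_max Y)%:E).
Proof.
move=> i0 alpha_max.
(* The default value [alpha i0] is one of the terms, so the maximum is attained at some index. *)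
have [m [-> am]] : exists m, alpha_max = alpha m /\ forall i, alpha i <= alpha m.
  case: (@arg_maxP _ _ _ i0 xpredT alpha isT) => m _ am; exists m; split=> [|i].
    apply/eqP; rewrite eq_le le_bigmax andbT.
    by apply/bigmax_leP; split=> [|i _]; exact: am.
  exact: am.
split=> [A|].
  by split; [exact: Pareto_sum_optimal_IQD am|exact: sum_optimal_Pareto].
split=> [lambda l0 Y|Y]; last exact: boxplus_IQD.
have [k [-> lk]] : exists k, \big[Num.min/lambda i0]_(i < n) lambda i = lambda k /\
    forall i, lambda k <= lambda i.
  case: (@arg_minP _ _ _ i0 xpredT lambda isT) => k _ lk; exists k; split=> [|i].
    apply/eqP; rewrite eq_le bigmin_le.
    by apply/bigmin_geP; split=> [|i _]; exact: lk.
  exact: lk.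
exact: boxplus_scaled_IQD.
Qed.
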